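(* Let $m\ge 2$ be an integer, let $c_+:\mathbb{R}\to\mathbb{R}$ be a smooth function with $c_+(x)>0$ for all $x\in\mathbb{R}$, let $a_1<0$ be a real number and $a_2=1$. Let $$X:=\Big\{(x_1,x_2,t,(y_j)_{j=1}^{m-1})\in\mathbb{R}^2\times [a_1,a_2]\times\mathbb{R}^{m-1}\;\Big|\; x_2-t\,c_+(x_1)=0,\ (t-a_1)(a_2-t)-\sum_{j=1}^{m-1}y_j^2=0\Big\}\subset\mathbb{R}^{m+2},$$ which is an $m$-dimensional smooth submanifold of $\mathbb{R}^{m+2}$ without boundary on which $\pi_{m+2,1}|_X$ has no critical point, and let $(\pi_{m+2,1}|_X)':X\to\mathbb{R}$ be the 1st derivative of $\pi_{m+2,1}|_X$ (defined in the context). Then the critical set $S\big((\pi_{m+2,1}|_X)'\big)$ is the set of all points of $X$ satisfying at least one of the following four conditions: (1) the point is of the form $(x_1,c_+(x_1),1,(0)_{j=1}^{m-1})$ with $c_+''(x_1)=0$; (2) the point is of the form $(x_1,a_1c_+(x_1),a_1,(0)_{j=1}^{m-1})$ with $c_+''(x_1)=0$; (3) the point is of the form $(x_1,0,0,(y_j)_{j=1}^{m-1})\in X$; (4) the point is of the form $(x_1,t\,c_+(x_1),t,(y_j)_{j=1}^{m-1})\in X$ with $x_1$ a critical point of $c_+$ (i.e. $c_+'(x_1)=0$). In addition, a point $p\in X$ satisfies (3) or (4) if and only if $(\pi_{m+2,1}|_X)'(p)=1$.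
   Context: Smooth means $C^\infty$. $\pi_{m+k,1}:\mathbb{R}^{m+k}\to\mathbb{R}$ is the projection to the first coordinate (here $x_1$). For a real-valued smooth function $f$ on a manifold, $S(f)$ (the critical set) is the set of points where the differential of $f$ vanishes. 1st derivative: let $X^m\subset\mathbb{R}^{m+k}$ ($k>0$) be an $m$-dimensional smooth submanifold without boundary such that $\pi_{m+k,1}|_{X^m}$ has no critical point, with the Riemannian metric induced from the standard Euclidean metric. For each $p\in X^m$ there is a unique unit vector $v_{\mathrm{u},p,+}\in T_pX^m$ that is orthogonal to every element of the kernel of $d(\pi_{m+k,1}|_{X^m})_p$ and is mapped by $d(\pi_{m+k,1}|_{X^m})_p$ to a vector of $T_{\pi_{m+k,1}(p)}\mathbb{R}\cong\mathbb{R}$ identified with a positive number $a_{v_{\mathrm{u},p,+}}$. The 1st derivative $(\pi_{m+k,1}|_{X^m})':X^m\to\mathbb{R}$ is the smooth function $p\mapsto a_{v_{\mathrm{u},p,+}}$; it satisfies $0<a_{v_{\mathrm{u},p,+}}\le1$. *)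

(* Defs.v *)
From mathcomp Require Export all_boot all_order all_algebra.
From mathcomp Require Export all_classical all_reals all_analysis.

Set Implicit Arguments.
Unset Strict Implicit.
Unset Printing Implicit Defensive.

Import Order.TTheory GRing.Theory Num.Theory.
Import numFieldNormedType.Exports.

Local Open Scope ring_scope.
Local Open Scope classical_set_scope.

(* [U] is meant to be open.  In finite dimension this is the usual C^k: all
   iterated directional derivatives of order at most k exist and are
   continuous. *)
Fixpoint Ck_on (R : realType) (V W : normedModType R) (k : nat) (U : set V)
    (f : V -> W) : Prop :=
  if k is k'.+1 then
    (forall x, U x -> differentiable f x) /\
    (forall v : V, Ck_on k' U (fun x => 'D_v f x))
  else forall x, U x -> {for x, continuous f}.

Definition smooth_on (R : realType) (V W : normedModType R) (U : set V)
    (f : V -> W) : Prop := forall k, Ck_on k U f.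

(* The norm of ['rV[R]_n] in the library is the sup norm, so the Euclidean inner
   product, which induces the Riemannian metric, is written out. *)
Definition edot (R : realType) (n : nat) (u v : 'rV[R]_n) : R :=
  \sum_(i < n) u 0 i * v 0 i.

(* m-dimensional smooth submanifold (without boundary) of R^n: locally the zero
   set of a smooth submersion to R^(n - m). *)
Definition submanifold (R : realType) (n m : nat) (X : set 'rV[R]_n) : Prop :=
  exists k : nat, (m + k)%N = n /\
    forall p, X p ->
      exists (U : set 'rV[R]_n) (h : 'rV[R]_n -> 'rV[R]_k),
        [/\ open U, U p, smooth_on U h,
            forall x, U x -> forall w, exists v, 'd h x v = w
          & X `&` U = [set x | U x /\ h x = 0]].

(* Smooth curve germ in [X] at [p] with velocity [v] at time 0. *)
Definition curve_in (R : realType) (n : nat) (X : set 'rV[R]_n)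
    (p v : 'rV[R]_n) (g : R -> 'rV[R]_n) : Prop :=
  [/\ g 0 = p,
      exists2 e : R, 0 < e &
        smooth_on (ball (0 : R) e) g /\ forall s, ball (0 : R) e s -> X (g s)
    & g^`() 0 = v].

Definition tangent (R : realType) (n : nat) (X : set 'rV[R]_n)
    (p : 'rV[R]_n) : set 'rV[R]_n :=
  [set v | exists g, curve_in X p v g].

(* For [v] tangent to [X] at [p]: the differential at [p] of the restriction of
   [f] to [X] sends [v] to [a].  Only the values of [f] on [X] matter. *)
Definition diff_maps_to (R : realType) (n : nat) (X : set 'rV[R]_n)
    (f : 'rV[R]_n -> R) (p v : 'rV[R]_n) (a : R) : Prop :=
  forall g, curve_in X p v g -> is_derive (0 : R) (1 : R) (f \o g) a.

Definition diff_kernel (R : realType) (n : nat) (X : set 'rV[R]_n)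
    (f : 'rV[R]_n -> R) (p : 'rV[R]_n) : set 'rV[R]_n :=
  [set v | tangent X p v /\ diff_maps_to X f p v 0].

Definition critical_set (R : realType) (n : nat) (X : set 'rV[R]_n)
    (f : 'rV[R]_n -> R) : set 'rV[R]_n :=
  [set p | X p /\ forall v, tangent X p v -> diff_maps_to X f p v 0].

Definition first_coord (R : realType) (n : nat) (p : 'rV[R]_n.+1) : R := p 0 0.

(* [v] is the unit vector orthogonal to the kernel of the differential of the
   first projection that this differential sends to the positive number [a]. *)
Definition is_upward_unit (R : realType) (n : nat) (X : set 'rV[R]_n.+1)
    (p v : 'rV[R]_n.+1) (a : R) : Prop :=
  [/\ tangent X p v,
      edot v v = 1,
      forall w, diff_kernel X (@first_coord R n) p w -> edot v w = 0,
      diff_maps_to X (@first_coord R n) p v a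
    & 0 < a].

(* Where no such [a] exists (in particular off [X]) the value is the junk 0. *)
Definition first_derivative (R : realType) (n : nat) (X : set 'rV[R]_n.+1)
    (p : 'rV[R]_n.+1) : R :=
  xget 0 [set a | exists v, is_upward_unit X p v a].

(* The point (x1, x2, t, y_1, ..., y_(m-1)) of R^(m+2), for 0 < m. *)
Definition point (R : realType) (m : nat) (x1 x2 t : R) (y : 'rV[R]_m.-1) :
    'rV[R]_m.+2 :=
  \row_(i < m.+2) nth 0 [:: x1, x2, t & [seq y 0 j | j <- enum 'I_m.-1]] i.

Definition Xset (R : realType) (m : nat) (c : R -> R) (a1 a2 : R) :
    set 'rV[R]_m.+2 :=
  [set p | exists x1 x2 t (y : 'rV[R]_m.-1),
     [/\ p = point x1 x2 t y,
         a1 <= t <= a2,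
         x2 - t * c x1 = 0
       & (t - a1) * (a2 - t) - \sum_(j < m.-1) y 0 j ^+ 2 = 0]].

Arguments Xset {R} m c a1 a2.

(* Main.v *)
Require Import Defs.
From mathcomp Require Import ring lra.
Import Order.TTheory GRing.Theory Num.Theory.
Import numFieldNormedType.Exports.
Local Open Scope ring_scope.
Local Open Scope classical_set_scope.
Set Implicit Arguments.
Unset Strict Implicit.
Unset Printing Implicit Defensive.

(** Write [t] and [y] for the last coordinates of a point of [X] and put
    [r = (1 - a1) / 2], [b = 1 + a1 - 2 t], [q = |y|^2].  The equation
    [(t - a1)(1 - t) = q] says that [(t, y)] lies on the sphere of radius [r]
    about [((1 + a1) / 2, 0)], so [q + (b / 2)^2 = r^2]: the normals
    [(- t c'(x), 1, - c(x), 0)] and [(0, 0, b, - 2 y)] are independent along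
    [X], and [X] is the graph of [t c(x)] over the line times that sphere.

    The value at [p] of the first derivative is [1 / |N|], where [N] is the
    tangent vector with first coordinate 1 that is orthogonal to the kernel of
    the projection.  Minimizing the length among the tangent vectors with first
    coordinate 1 gives [N] ([upward]), and
      [|N|^2 = 1 + (t c'(x) r)^2 / (c(x)^2 q + r^2)]   ([upward_norm]).
    Hence the first derivative is the square root of [D / (D + E)] with
    [D = c(x)^2 q + r^2] and [E = (t c'(x) r)^2] ([first_derivativeE]); it is 1
    exactly where [t = 0] or [c'(x) = 0].

    Differentiating along a curve of [X] with velocity [v] produces a positive
    multiple of [D' E - D E'], and this carries the factor [t c'(x)], so that
    the points where the value is 1 are critical.  Suppose that [t c'(x)] is
    nonzero.
    - If [y = 0], then [t] is stationary on [X], only the variation of [x]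
      remains, and the other factor is a multiple of [- 2 D t c''(x)]: the point
      is critical exactly when [c''(x) = 0].  The points with [y = 0] are those
      over the two poles [t = 1] and [t = a1] of the sphere ([X_pole]).
    - If [y <> 0], then [t] can vary while [x] stays put, and the point is never
      critical, because [2 D - t c(x)^2 b] equals
      [c(x)^2 ((1 - t)(- a1) + (t - a1)) + 2 r^2], which is positive on
      [a1 <= t <= 1].
    This is [critical_first_derivative].

    Tangent vectors are velocities of smooth curves, so all of this needs the
    tangent space of [X] in terms of equations ([tangentP]).  Differentiating
    the equations of [X] gives one inclusion; for the other, a rational
    parametrization of a circle of the sphere realizes every velocity
    ([circle_coord], [X_curve]).  The smoothness of these curves, and of the
    equations of [X], follows from closure properties of the C^k classes. *)

(** * Calculus of C^k functions *)

(** Differentiability is a statement about the germ: the differential of [f] is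
    a first-order expansion of [g] as well, and such an expansion is unique. *)
Lemma near_eq_differentiable (R : realType) (V W : normedModType R)
    (f g : V -> W) (x : V) :
  {near x, f =1 g} -> differentiable f x -> differentiable g x.
Proof.
move=> fg df.
have fxgx : f x = g x by exact: nbhs_singleton fg.
have E : g \o shift x = cst (g x) + 'd f x +o_ (0 : V) id.
  apply/eqaddoP => e e0.
  have /eqaddoP/(_ _ e0) fe := diff_locally df.
  have fg0 : \forall y \near (0 : V), f (y + x) = g (y + x).
    by have := fg; rewrite (near_shift (0 : V)) /= subr0.
  near=> y.
  have fgy : f (y + x) = g (y + x) by near: y.
  have <- : (f \o shift x - (cst (f x) + 'd f x)) y =
            (g \o shift x - (cst (g x) + 'd f x)) y.
    rewrite -[LHS]/(f (y + x) - (f x + 'd f x y)).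
    by rewrite -[RHS]/(g (y + x) - (g x + 'd f x y)) fgy fxgx.
  by near: y.
apply/diff_locallyP.
have -> : 'd g x = 'd f x :> (V -> W).
  by apply: diff_unique => //; exact: diff_continuous.
by split => //; exact: diff_continuous.
Unshelve. all: by end_near. Qed.

(** This makes the inductions below work: a formula for a directional derivative
    is only available on [U], while [Ck_on] is about the total function. *)
Lemma Ck_on_ext (R : realType) (V W : normedModType R) k (U : set V)
    (f g : V -> W) : open U -> (forall x, U x -> f x = g x) ->
  Ck_on k U f -> Ck_on k U g.
Proof.
move=> oU; have nearU (f' g' : V -> W) : (forall x, U x -> f' x = g' x) ->
    forall x, U x -> {near x, f' =1 g'}.
  move=> fg x Ux; have := open_nbhs_nbhs (conj oU Ux).
  by apply: filterS => y Uy; exact: fg.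
elim: k f g => [|k IH] f g fg /=.
  move=> fc x Ux; have := fc x Ux.
  rewrite /prop_for /continuous_at -(fg x Ux) => fx.
  by apply: cvg_trans fx; apply: near_eq_cvg; exact: nearU.
case=> df Df; split=> [x Ux|v].
  by apply: near_eq_differentiable (df x Ux); exact: nearU.
by apply: IH (Df v) => x Ux; apply: near_eq_derive; exact: nearU.
Qed.

Lemma Ck_onW (R : realType) (V W : normedModType R) k (U : set V)
    (f : V -> W) : Ck_on k.+1 U f -> Ck_on k U f.
Proof.
elim: k f => [f [df _] x Ux|k IH f [df Df]].
  exact: differentiable_continuous (df x Ux).
by split => // v; exact/IH/Df.
Qed.

Lemma smooth_on_derive1 (R : realType) (c : R -> R) :
  smooth_on [set: R] c -> smooth_on [set: R] c^`().
Proof.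
move=> cs k; have [_ /(_ 1)] := cs k.+1.
by apply: Ck_on_ext => [|x _]; [exact: openT | rewrite derive1E].
Qed.

Lemma Ck_on_cst (R : realType) (V W : normedModType R) k (U : set V) (w : W) :
  open U -> Ck_on k U (cst w : V -> W).
Proof.
move=> oU; elim: k w => [w x _|k IH w]; first exact: cvg_cst.
split=> [x _|v]; first exact: differentiable_cst.
by apply: Ck_on_ext (IH 0) => // x _; rewrite derive_cst.
Qed.

Lemma Ck_onD (R : realType) (V W : normedModType R) k (U : set V)
    (f g : V -> W) : open U ->
  Ck_on k U f -> Ck_on k U g -> Ck_on k U (fun x => f x + g x).
Proof.
move=> oU; elim: k f g => [f g fc gc x Ux|k IH f g [df Df] [dg Dg]].
  by apply: continuousD; [exact: fc | exact: gc].
split=> [x Ux|v]; first by apply: differentiableD; [exact: df | exact: dg].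
apply: Ck_on_ext (IH _ _ (Df v) (Dg v)) => // x Ux.
by rewrite deriveD //; apply: diff_derivable; [exact: df | exact: dg].
Qed.

Lemma Ck_onM (R : realType) (V : normedModType R) k (U : set V)
    (f g : V -> R) : open U ->
  Ck_on k U f -> Ck_on k U g -> Ck_on k U (fun x => f x * g x).
Proof.
move=> oU; elim: k f g => [f g fc gc x Ux|k IH f g fk gk].
  by apply: continuousM; [exact: fc | exact: gc].
have [df Df] := fk; have [dg Dg] := gk.
split=> [x Ux|v]; first by apply: differentiableM; [exact: df | exact: dg].
have fgv := Ck_onD oU (IH _ _ (Ck_onW fk) (Dg v)) (IH _ _ (Ck_onW gk) (Df v)).
apply: Ck_on_ext fgv => // x Ux.
by rewrite deriveM //; apply: diff_derivable; [exact: df | exact: dg].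
Qed.

(** The derivative [- f^-2 f'] involves [f^-1] itself, to which the induction
    hypothesis applies one order below. *)
Lemma Ck_onV (R : realType) (V : normedModType R) k (U : set V)
    (f : V -> R) : open U -> (forall x, U x -> f x != 0) ->
  Ck_on k U f -> Ck_on k U (fun x => (f x)^-1).
Proof.
move=> oU f0; elim: k => [fc x Ux|k IH fk].
  by apply: cvgV; [exact: f0 | exact: fc].
have [df Df] := fk.
split=> [x Ux|v]; first by apply: differentiableV; [exact: df | exact: f0].
have Vf := IH (Ck_onW fk).
have Vf' := Ck_onM oU
  (Ck_onM oU (@Ck_on_cst _ _ R k _ (-1) oU) (Ck_onM oU Vf Vf)) (Df v).
apply: Ck_on_ext Vf' => // x Ux.
rewrite deriveV; [|exact: f0|exact/diff_derivable/df].
by rewrite /= mulN1r -invfM -expr2.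
Qed.

Lemma Ck_onZl (R : realType) (V W : normedModType R) k (U : set V)
    (f : V -> R) (w : W) : open U ->
  Ck_on k U f -> Ck_on k U (fun x => f x *: w).
Proof.
move=> oU; elim: k f => [f fc x Ux|k IH f [df Df]].
  by apply: cvgZr_tmp; exact: fc.
split=> [x Ux|v]; first exact/differentiableZl/df.
apply: Ck_on_ext (IH _ (Df v)) => // x Ux.
have dfx := df x Ux; have dfw := differentiableZl w dfx.
by rewrite (deriveE v dfw) (deriveE v dfx) diffZl.
Qed.

Lemma is_derive_comp1 (R : realType) (V : normedModType R) (c : R -> R)
    (f : V -> R) x v a : differentiable c (f x) -> differentiable f x ->
  is_derive x v f a ->
  is_derive x v (fun y => c (f y)) (c^`()%classic (f x) * a).
Proof.
move=> dc df [_ <-].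
have dcf : differentiable (c \o f) x by exact: differentiable_comp.
apply: DeriveDef; first exact: diff_derivable.
rewrite (deriveE v dcf) (deriveE v df) (diff_comp df dc) /=.
by rewrite deriv1E; [rewrite /= mulrC | exact/derivable1_diffP].
Qed.

(** The induction must range over [c] too, as the chain rule replaces [c] by its
    derivative. *)
Lemma Ck_on_comp1 (R : realType) (V : normedModType R) k (U : set V)
    (c : R -> R) (f : V -> R) : open U -> smooth_on [set: R] c ->
  Ck_on k U f -> Ck_on k U (fun x => c (f x)).
Proof.
move=> oU; elim: k c f => [c f cs fc x Ux|k IH c f cs fk].
  by apply: continuous_comp; [exact: fc | exact: cs 0%N _ _].
have [df Df] := fk; have dc y : differentiable c y by exact: (cs 1%N).1.
split=> [x Ux|v]; first by apply: differentiable_comp => //; exact: df.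
have fk' := Ck_onM oU (Df v) (IH _ _ (smooth_on_derive1 cs) (Ck_onW fk)).
apply: Ck_on_ext fk' => // x Ux.
have dfv : derivable f x v by exact/diff_derivable/df.
have [_ ->] := is_derive_comp1 (dc _) (df x Ux) (derivableP dfv).
by rewrite mulrC.
Qed.

Lemma Ck_on_id (R : realType) (V : normedModType R) k (U : set V) :
  open U -> Ck_on k U (id : V -> V).
Proof.
move=> oU; case: k => [x _|k]; first exact: cvg_id.
split=> [x _|v]; first by have [] := is_diff_id x.
by apply: Ck_on_ext (Ck_on_cst k v oU) => // x _; rewrite derive_id.
Qed.

Lemma Ck_on_coord (R : realType) n k (U : set 'rV[R]_n) (i : 'I_n) :
  open U -> Ck_on k U (fun x : 'rV[R]_n => x 0 i).
Proof.
move=> oU; case: k => [x _|k]; first exact: coord_continuous.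
split=> [x _|v]; first exact: differentiable_coord.
apply: Ck_on_ext (Ck_on_cst k (v 0 i) oU) => // x _ /=.
have := @derive_mx R _ 1 n id x v (@derivable_id _ _ _ _).
by rewrite derive_id => /matrixP/(_ 0 i); rewrite mxE.
Qed.

Lemma smooth_on_cst (R : realType) (V W : normedModType R) (U : set V) (w : W) :
  open U -> smooth_on U (cst w : V -> W).
Proof. by move=> oU k; exact: Ck_on_cst. Qed.

Lemma smooth_onD (R : realType) (V W : normedModType R) (U : set V)
    (f g : V -> W) : open U ->
  smooth_on U f -> smooth_on U g -> smooth_on U (fun x => f x + g x).
Proof. by move=> oU fs gs k; exact: Ck_onD. Qed.

Lemma smooth_onM (R : realType) (V : normedModType R) (U : set V)
    (f g : V -> R) : open U ->
  smooth_on U f -> smooth_on U g -> smooth_on U (fun x => f x * g x).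
Proof. by move=> oU fs gs k; exact: Ck_onM. Qed.

Lemma smooth_onN (R : realType) (V : normedModType R) (U : set V)
    (f : V -> R) : open U -> smooth_on U f -> smooth_on U (fun x => - f x).
Proof.
move=> oU fs k.
apply: Ck_on_ext (Ck_onM oU (@Ck_on_cst _ _ R k _ (-1) oU) (fs k)) => // x _ /=.
by rewrite mulN1r.
Qed.

Lemma smooth_on_sum (R : realType) (V W : normedModType R) (U : set V)
    n (F : 'I_n -> V -> W) : open U ->
  (forall i, smooth_on U (F i)) -> smooth_on U (fun x => \sum_(i < n) F i x).
Proof.
move=> oU Fs k; elim: (index_enum _) => [|i s IH].
  by apply: Ck_on_ext (Ck_on_cst k 0 oU) => // x _; rewrite big_nil.
by apply: Ck_on_ext (Ck_onD oU (Fs i k) IH) => // x _; rewrite big_cons.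
Qed.

(** A vector-valued function is the sum of its coordinates times the basis
    vectors, hence inherits their smoothness. *)
Lemma smooth_on_row (R : realType) (V : normedModType R) (U : set V) n
    (f : V -> 'rV[R]_n) : open U ->
  (forall i, smooth_on U (fun x => f x 0 i)) -> smooth_on U f.
Proof.
move=> oU fs k.
have /(_ k) Es : smooth_on U
    (fun x => \sum_(i < n) f x 0 i *: delta_mx 0 i : 'rV[R]_n).
  by apply: smooth_on_sum => // i k'; exact: (Ck_onZl _ oU (fs i k')).
by apply: Ck_on_ext Es => // x _; rewrite -row_sum_delta.
Qed.

(** * Derivatives of pointwise expressions *)

Section PointwiseDerivatives.
Context (R : realType) (V : normedModType R).
Implicit Types (f g : V -> R) (x v : V) (a b : R).

Lemma is_derive_addf f g x v a b : is_derive x v f a -> is_derive x v g b ->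
  is_derive x v (fun y => f y + g y) (a + b).
Proof. by move=> fa gb; exact: is_deriveD. Qed.

Lemma is_derive_subf f g x v a b : is_derive x v f a -> is_derive x v g b ->
  is_derive x v (fun y => f y - g y) (a - b).
Proof. by move=> fa gb; exact: is_deriveB. Qed.

Lemma is_derive_mulf f g x v a b : is_derive x v f a -> is_derive x v g b ->
  is_derive x v (fun y => f y * g y) (f x * b + g x * a).
Proof. by move=> fa gb; exact: is_deriveM. Qed.

Lemma is_derive_invf f x v a : f x != 0 -> is_derive x v f a ->
  is_derive x v (fun y => (f y)^-1) (- (f x) ^- 2 * a).
Proof.
move=> f0 [df <-]; apply: DeriveDef; first exact: derivableV.
exact: deriveV.
Qed.

Lemma is_derive_edot n (u : V -> 'rV[R]_n) (du : 'rV[R]_n) x v :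
  (forall j, is_derive x v (fun y => u y 0 j) (du 0 j)) ->
  is_derive x v (fun y => edot (u y) (u y)) (2 * edot (u x) du).
Proof.
move=> ud.
have -> : (fun y => edot (u y) (u y)) =
    \sum_(j < n) (fun y => u y 0 j * u y 0 j).
  by apply/funext => y; rewrite fct_sumE.
have dsum := is_derive_sum (fun j => is_derive_mulf (ud j) (ud j)).
apply: is_derive_eq dsum _.
by rewrite /edot mulr_sumr; apply: eq_bigr => j _; rewrite mulr_natl mulr2n.
Qed.

End PointwiseDerivatives.

(** * The Euclidean inner product and the coordinates (x, z, t, y) *)

Section EuclideanProduct.
Context (R : realType) (n : nat).
Implicit Types u v w : 'rV[R]_n.

Lemma edotC u v : edot u v = edot v u.
Proof. by apply: eq_bigr => i _; rewrite mulrC. Qed.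

Lemma edotDl u v w : edot (u + v) w = edot u w + edot v w.
Proof. by rewrite -big_split; apply: eq_bigr => i _; rewrite mxE mulrDl. Qed.

Lemma edotZl k u v : edot (k *: u) v = k * edot u v.
Proof. by rewrite mulr_sumr; apply: eq_bigr => i _; rewrite mxE mulrA. Qed.

Lemma edotDr u v w : edot w (u + v) = edot w u + edot w v.
Proof. by rewrite edotC edotDl !(edotC w). Qed.

Lemma edotZr k u v : edot u (k *: v) = k * edot u v.
Proof. by rewrite edotC edotZl edotC. Qed.

Lemma edot_ge0 u : 0 <= edot u u.
Proof. by apply: sumr_ge0 => i _; rewrite -expr2 sqr_ge0. Qed.

Lemma edot_eq0 u : edot u u = 0 -> u = 0.
Proof.
move=> /eqP; rewrite psumr_eq0 => [/allP u0|i _]; last first.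
  by rewrite -expr2 sqr_ge0.
apply/rowP => i; have := u0 i (mem_index_enum i).
by rewrite -expr2 sqrf_eq0 mxE => /eqP.
Qed.

Lemma edot0l v : edot 0 v = 0.
Proof. by apply: big1 => i _; rewrite mxE mul0r. Qed.

End EuclideanProduct.

Section Coordinates.
Context (R : realType) (n : nat).
Implicit Types p q v : 'rV[R]_n.+3.

Definition xco p : R := p 0 0.
Definition zco p : R := p 0 (@Ordinal n.+3 1 isT).
Definition tco p : R := p 0 (@Ordinal n.+3 2 isT).
Definition yco p : 'rV[R]_n := \row_j p 0 (rshift 3 j).

Lemma ord3P (P : 'I_n.+3 -> Prop) : P 0 -> P (@Ordinal n.+3 1 isT) ->
  P (@Ordinal n.+3 2 isT) -> (forall j : 'I_n, P (rshift 3 j)) -> forall i, P i.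
Proof.
move=> P0 P1 P2 Pj [[|[|[|i]]] lti].
- by rewrite (_ : Ordinal lti = 0) //; exact: val_inj.
- by rewrite (bool_irrelevance lti isT).
- by rewrite (bool_irrelevance lti isT).
- rewrite (_ : Ordinal lti = rshift 3 (Ordinal (lti : (i < n)%N))) //.
  exact: val_inj.
Qed.

Lemma row_coord_inj p q : xco p = xco q -> zco p = zco q -> tco p = tco q ->
  yco p = yco q -> p = q.
Proof.
move=> ex ez et /rowP ey; apply/rowP; apply: ord3P => // j.
by have := ey j; rewrite !mxE.
Qed.

Lemma xco_lin a b p q : xco (a *: p + b *: q) = a * xco p + b * xco q.
Proof. by rewrite /xco !mxE. Qed.

Lemma zco_lin a b p q : zco (a *: p + b *: q) = a * zco p + b * zco q.
Proof. by rewrite /zco !mxE. Qed.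

Lemma tco_lin a b p q : tco (a *: p + b *: q) = a * tco p + b * tco q.
Proof. by rewrite /tco !mxE. Qed.

Lemma yco_lin a b p q : yco (a *: p + b *: q) = a *: yco p + b *: yco q.
Proof. by apply/rowP => j; rewrite !mxE. Qed.

Lemma edot_coord p q : edot p q =
  xco p * xco q + zco p * zco q + tco p * tco q + edot (yco p) (yco q).
Proof.
rewrite {1}/edot 3!big_ord_recl -!addrA; congr (_ + _).
congr (_ + _); first by congr (p _ _ * q _ _); exact: val_inj.
congr (_ + _); first by congr (p _ _ * q _ _); exact: val_inj.
by apply: eq_bigr => j _; rewrite !mxE; congr (p _ _ * q _ _); exact: val_inj.
Qed.

Lemma xco_point x z t y : xco (@point R n.+1 x z t y) = x.
Proof. by rewrite /xco mxE. Qed.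

Lemma zco_point x z t y : zco (@point R n.+1 x z t y) = z.
Proof. by rewrite /zco mxE. Qed.

Lemma tco_point x z t y : tco (@point R n.+1 x z t y) = t.
Proof. by rewrite /tco mxE. Qed.

Lemma yco_point x z t y : yco (@point R n.+1 x z t y) = y.
Proof.
apply/rowP => j; rewrite !mxE /= (nth_map j) ?size_enum_ord.
  by rewrite nth_ord_enum.
exact: ltn_ord.
Qed.

Definition coE := (xco_point, zco_point, tco_point, yco_point).

Lemma point_coord p : p = @point R n.+1 (xco p) (zco p) (tco p) (yco p).
Proof. by apply: row_coord_inj; rewrite coE. Qed.

Lemma is_derive_row_coord (i : 'I_n.+3) p v :
  is_derive p v (fun q : 'rV[R]_n.+3 => q 0 i) (v 0 i).
Proof.
have did := @derivable_id R 'rV[R]_n.+3 p v.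
have /derivable_mxP/(_ 0 i) di := did.
apply: DeriveDef => //.
have := derive_mx did.
by rewrite derive_id => /matrixP/(_ 0 i); rewrite mxE => ->.
Qed.

End Coordinates.

(** * Curves in a set *)

Section Curves.
Context (R : realType) (n : nat) (X : set 'rV[R]_n) (p v : 'rV[R]_n)
  (g : R -> 'rV[R]_n) (gX : curve_in X p v g).

Lemma curve_is_derive i : is_derive (0 : R) 1 (fun s => g s 0 i) (v 0 i).
Proof.
have [_ [e e0 [gs _]] gv] := gX.
have dg : derivable g 0 1.
  by apply: diff_derivable; apply: (gs 1%N).1; exact: ballxx.
have /derivable_mxP/(_ 0 i) dgi := dg.
apply: DeriveDef => //.
by have := derive_mx dg; rewrite -derive1E gv => /matrixP/(_ 0 i); rewrite mxE.
Qed.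

Lemma curve_near : \forall s \near (0 : R), X (g s).
Proof.
have [_ [e e0 [_ gsX]] _] := gX.
by apply: filterS (nbhsx_ballx (0 : R) e e0) => s; exact: gsX.
Qed.

End Curves.

(** * A rational motion on a sphere *)

Section Circle.
Context (R : realType).
Implicit Types k u w s : R.

(** If [u] lies on the sphere of radius [r] about 0, if [w] is orthogonal to [u]
    and [k = |w|^2 / (2 r)^2], then the curve with these coordinates stays on
    the sphere: as [(1 + k s^2)^2 - (1 - k s^2)^2 = 4 k s^2], its squared norm
    is [r^2] for every [s]. *)
Definition circle_coord k u w s : R :=
  ((1 - k * (s * s)) * u + s * w) / (1 + k * (s * s)).

Lemma circle_den_neq0 k s : 0 <= k -> 1 + k * (s * s) != 0.
Proof.
move=> k0; rewrite gt_eqF // ltr_wpDr // mulr_ge0 //.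
by rewrite -expr2 sqr_ge0.
Qed.

Lemma circle_coord0 k u w : circle_coord k u w 0 = u.
Proof.
by rewrite /circle_coord !(mul0r, mulr0, subr0, addr0, mul1r, divr1).
Qed.

Lemma smooth_circle_coord k u w (U : set R) : 0 <= k -> open U ->
  smooth_on U (circle_coord k u w).
Proof.
move=> k0 oU.
have scst a : smooth_on U (cst a : R -> R) by exact: smooth_on_cst.
have ids : smooth_on U (id : R -> R) by move=> j; exact: Ck_on_id.
have kss := smooth_onM oU (scst k) (smooth_onM oU ids ids).
have num := smooth_onD oU
  (smooth_onM oU (smooth_onD oU (scst 1) (smooth_onN oU kss)) (scst u))
  (smooth_onM oU ids (scst w)).
apply: (smooth_onM oU num) => j; apply: (Ck_onV oU) => [s _|].
  exact: circle_den_neq0.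
exact: (smooth_onD oU (scst 1) kss).
Qed.

Lemma is_derive_circle_coord k u w :
  is_derive (0 : R) 1 (circle_coord k u w) w.
Proof.
have ids : is_derive (0 : R) 1 (id : R -> R) 1 by exact: is_derive_id.
have dcst a : is_derive (0 : R) 1 (cst a : R -> R) 0 by exact: is_derive_cst.
have kss := is_derive_mulf (dcst k) (is_derive_mulf ids ids).
have num := is_derive_addf
  (is_derive_mulf (is_derive_subf (dcst 1) kss) (dcst u))
  (is_derive_mulf ids (dcst w)).
have den0 : 1 + k * (0 * 0) != 0 by rewrite mulr0 mulr0 addr0 oner_eq0.
have inv := @is_derive_invf R R (fun s => 1 + k * (s * s)) 0 1 _ den0
  (is_derive_addf (dcst 1) kss).
apply: is_derive_eq (is_derive_mulf num inv) _; rewrite /=.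
rewrite !(mulr0, mul0r, addr0, subr0, oppr0, add0r, mul1r, mulr1).
by rewrite invr1 mul1r.
Qed.

End Circle.

(** * The submanifold X and its tangent vectors *)

Section Hypersurface.
Context (R : realType) (n : nat) (c : R -> R) (a1 : R).
Context (c_smooth : smooth_on [set: R] c) (a1_lt0 : a1 < 0).
Local Notation X := (@Xset R n.+1 c a1 1).
Local Notation c' := (c^`()).
Local Notation c'' := (c^`()^`()).
Implicit Types p v w : 'rV[R]_n.+3.

Lemma c_diff x : differentiable c x.
Proof. exact: (c_smooth 1%N).1. Qed.

Lemma c'_diff x : differentiable c' x.
Proof. exact: (smooth_on_derive1 c_smooth 1%N).1. Qed.

Lemma XsetP p : X p <-> zco p = tco p * c (xco p) /\
  (tco p - a1) * (1 - tco p) = edot (yco p) (yco p).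
Proof.
have sq (y : 'rV[R]_n) : \sum_(j < n) y 0 j ^+ 2 = edot y y by [].
split=> [[x [z [t [y [-> _ ez et]]]]]|[ez et]].
  by rewrite !coE -sq; split; apply: subr0_eq.
exists (xco p), (zco p), (tco p), (yco p); split.
- exact: point_coord.
- have := edot_ge0 (yco p); rewrite -et => q0.
  have a1_lt1 : a1 < 1 by exact: lt_trans a1_lt0 ltr01.
  apply/andP; split; rewrite leNgt; apply/negP => lt_t.
    have : 0 < (a1 - tco p) * (1 - tco p) by rewrite mulr_gt0 ?subr_gt0 //; lra.
    by move: q0; lra.
  have : 0 < (tco p - a1) * (tco p - 1) by rewrite mulr_gt0 ?subr_gt0 //; lra.
  by move: q0; lra.
- by rewrite ez subrr.
- by rewrite sq et subrr.
Qed.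

(** The linearization at [p] of the two equations of [X], applied to [v]; by
    [tangentP] its solutions are the tangent vectors. *)
Definition tangent_eqs p v :=
  zco v = tco v * c (xco p) + tco p * (c' (xco p) * xco v) /\
  (1 + a1 - 2 * tco p) * tco v = 2 * edot (yco p) (yco v).

Lemma tangent_eqs_of_curve p v g : curve_in X p v g -> tangent_eqs p v.
Proof.
move=> gX; have dg := curve_is_derive gX; have [g0 _ _] := gX.
have dx : is_derive (0 : R) 1 (fun s => xco (g s)) (xco v) by exact: dg.
have dz : is_derive (0 : R) 1 (fun s => zco (g s)) (zco v) by exact: dg.
have dt : is_derive (0 : R) 1 (fun s => tco (g s)) (tco v) by exact: dg.
have dy : is_derive (0 : R) 1 (fun s => edot (yco (g s)) (yco (g s)))
    (2 * edot (yco (g 0)) (yco v)).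
  apply: is_derive_edot => j; rewrite mxE.
  by under eq_fun do rewrite mxE; exact: dg.
have dc : is_derive (0 : R) 1 (fun s => c (xco (g s))) (c' (xco (g 0)) * xco v).
  apply: is_derive_comp1 => //; first exact: c_diff.
  by apply/derivable1_diffP; have [] := dx.
have dcst a : is_derive (0 : R) 1 (cst a : R -> R) 0 by exact: is_derive_cst.
split.
- have := near_eq_is_derive _ (is_derive_mulf dt dc).
  move=> /(_ (fun s => zco (g s))) [].
    by apply: filterS (curve_near gX) => s /XsetP[-> _].
  by move=> _ E; have [_ E'] := dz; rewrite -E' E /= g0; ring.
- have := near_eq_is_derive _
    (is_derive_mulf (is_derive_subf dt (dcst a1)) (is_derive_subf (dcst 1) dt)).
  move=> /(_ (fun s => edot (yco (g s)) (yco (g s)))) [].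
    by apply: filterS (curve_near gX) => s /XsetP[_ ->].
  by move=> _ E; have [_ E'] := dy; rewrite -g0 -E' E /= g0; ring.
Qed.

(** The rate [k] of [circle_coord] for the velocity [(tco v, yco v)] on the
    sphere of radius [(1 - a1) / 2]. *)
Definition circle_rate v : R :=
  (tco v * tco v + edot (yco v) (yco v)) / (1 - a1) ^+ 2.

Lemma circle_rate_ge0 v : 0 <= circle_rate v.
Proof.
apply: divr_ge0; last exact: sqr_ge0.
by apply: addr_ge0; [rewrite -expr2 sqr_ge0 | exact: edot_ge0].
Qed.

(** The coordinate [x] moves linearly, [(t, y)] moves on a circle of its sphere,
    whose center has [t]-coordinate [(1 + a1) / 2], and [z] follows from the
    equation [z = t c(x)]. *)
Definition X_curve p v s : 'rV[R]_n.+3 :=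
  let k := circle_rate v in
  let x := xco p + s * xco v in
  let t := (1 + a1) / 2 + circle_coord k (tco p - (1 + a1) / 2) (tco v) s in
  @point R n.+1 x (t * c x) t
    (\row_j circle_coord k (yco p 0 j) (yco v 0 j) s).

Lemma X_curve_in_X p v s : X p -> tangent_eqs p v -> X (X_curve p v s).
Proof.
move=> /XsetP[_ pq] [_ pv]; apply/XsetP; rewrite !coE; split=> //.
have := circle_rate_ge0 v; set k := circle_rate v => k0.
have a1n : 1 - a1 != 0 by rewrite gt_eqF // subr_gt0 (lt_trans a1_lt0 ltr01).
have := circle_den_neq0 s k0; set Q := 1 + k * (s * s) => Q0.
have -> : (\row_j circle_coord k (yco p 0 j) (yco v 0 j) s) =
    Q^-1 *: ((1 - k * (s * s)) *: yco p + s *: yco v).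
  by apply/rowP => j; rewrite !mxE /circle_coord mulrC.
rewrite !(edotZl, edotZr, edotDl, edotDr) (edotC (yco v) (yco p)) -pq.
(* the second tangent equation says that (t - center, y) and the velocity of
   (t, y) are orthogonal *)
have -> : edot (yco p) (yco v) = (1 + a1 - 2 * tco p) * tco v / 2.
  by rewrite pv; field.
have -> : edot (yco v) (yco v) = k * (1 - a1) ^+ 2 - tco v * tco v.
  by rewrite /k /circle_rate divfK ?sqrf_eq0 // addrC addKr.
rewrite /circle_coord -/Q; move: Q0; rewrite /Q => Q0.
by field.
Qed.

Lemma X_curve_curve_in p v : X p -> tangent_eqs p v ->
  curve_in X p v (X_curve p v).
Proof.
move=> Xp pv; have [/XsetP[pz _] [vz _]] := (Xp, pv).
have k0 := circle_rate_ge0 v; set k := circle_rate v in k0 *.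
pose x s := xco p + s * xco v.
pose t s := (1 + a1) / 2 + circle_coord k (tco p - (1 + a1) / 2) (tco v) s.
have x0 : x 0 = xco p by rewrite /x mul0r addr0.
have t0 : t 0 = tco p by rewrite /t circle_coord0 addrC subrK.
have xE s : X_curve p v s 0 0 = x s by rewrite -/(xco _) coE.
have zE s : X_curve p v s 0 (@Ordinal n.+3 1 isT) = t s * c (x s).
  by rewrite -/(zco _) coE.
have tE s : X_curve p v s 0 (@Ordinal n.+3 2 isT) = t s.
  by rewrite -/(tco _) coE.
have yE s j : X_curve p v s 0 (rshift 3 j) =
    circle_coord k (yco p 0 j) (yco v 0 j) s.
  have /rowP/(_ j) := yco_point (x s) (t s * c (x s)) (t s)
    (\row_j circle_coord k (yco p 0 j) (yco v 0 j) s).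
  by rewrite !mxE.
have dcst a : is_derive (0 : R) 1 (cst a : R -> R) 0 by exact: is_derive_cst.
have dx : is_derive (0 : R) 1 x (xco v).
  have ids : is_derive (0 : R) 1 (id : R -> R) 1 by exact: is_derive_id.
  apply: is_derive_eq
    (is_derive_addf (dcst (xco p)) (is_derive_mulf ids (dcst (xco v)))) _.
  by rewrite /= mul0r mulr1 !add0r.
have dt : is_derive (0 : R) 1 t (tco v).
  apply: is_derive_eq
    (is_derive_addf (dcst _) (is_derive_circle_coord _ _ _)) _.
  by rewrite add0r.
have dz : is_derive (0 : R) 1 (fun s => t s * c (x s)) (zco v).
  have dc : is_derive (0 : R) 1 (fun s => c (x s)) (c' (x 0) * xco v).
    have diffx : differentiable x 0 by apply/derivable1_diffP; have [] := dx.
    exact: (is_derive_comp1 (c_diff _) diffx dx).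
  apply: is_derive_eq (is_derive_mulf dt dc) _.
  by rewrite vz x0 t0 addrC [c _ * _]mulrC.
have dg i : is_derive (0 : R) 1 (fun s => X_curve p v s 0 i) (v 0 i).
  elim/ord3P: i => [||| j].
  - by under eq_fun do rewrite xE.
  - by under eq_fun do rewrite zE.
  - by under eq_fun do rewrite tE.
  - under eq_fun do rewrite yE.
    by have := is_derive_circle_coord k (yco p 0 j) (yco v 0 j); rewrite !mxE.
split.
- apply/rowP; elim/ord3P => [||| j].
  + by rewrite xE x0.
  + by rewrite zE x0 t0 -pz.
  + by rewrite tE t0.
  + by rewrite yE circle_coord0 mxE.
- exists 1 => //; split; last by move=> s _; exact: X_curve_in_X.
  have oB : open (ball (0 : R) 1) by exact: ball_open.
  have sc a : smooth_on (ball (0 : R) 1) (cst a : R -> R).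
    exact: smooth_on_cst.
  have sx : smooth_on (ball (0 : R) 1) x.
    have ids : smooth_on (ball (0 : R) 1) (id : R -> R).
      by move=> j; exact: Ck_on_id.
    exact: (smooth_onD oB (sc _) (smooth_onM oB ids (sc _))).
  have st : smooth_on (ball (0 : R) 1) t.
    exact: (smooth_onD oB (sc _) (smooth_circle_coord _ _ k0 oB)).
  apply: (smooth_on_row oB); elim/ord3P => [||| j].
  + by under eq_fun do rewrite xE.
  + under eq_fun do rewrite zE.
    apply: (smooth_onM oB st) => j; exact: (Ck_on_comp1 oB c_smooth (sx j)).
  + by under eq_fun do rewrite tE.
  + by under eq_fun do rewrite yE; exact: smooth_circle_coord.
- have dX : derivable (X_curve p v) 0 1.
    by apply/derivable_mxP => i j; rewrite (ord1 i); have [] := dg j.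
  rewrite derive1E (derive_mx dX); apply/rowP => i.
  by rewrite mxE; have [_ ->] := dg i.
Qed.

Lemma tangentP p v : X p -> tangent X p v <-> tangent_eqs p v.
Proof.
move=> Xp; split=> [[g /tangent_eqs_of_curve] // | pv].
by exists (X_curve p v); exact: X_curve_curve_in.
Qed.

Lemma first_coord_maps_to p v a : tangent X p v ->
  diff_maps_to X (@first_coord R n.+2) p v a <-> a = xco v.
Proof.
move=> [g gX]; split=> [/(_ g gX) [_ <-]|-> h hX].
  by have [_ E] := curve_is_derive gX 0; exact: E.
exact: (curve_is_derive hX 0).
Qed.

Lemma tangent_lin p a b v w : X p -> tangent X p v -> tangent X p w ->
  tangent X p (a *: v + b *: w).
Proof.
move=> Xp /(tangentP _ Xp)[vz vt] /(tangentP _ Xp)[wz wt]; apply/tangentP => //.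
rewrite /tangent_eqs xco_lin zco_lin tco_lin yco_lin edotDr !edotZr vz wz.
split; first by ring.
have -> : 2 * (a * edot (yco p) (yco v) + b * edot (yco p) (yco w)) =
  a * (2 * edot (yco p) (yco v)) + b * (2 * edot (yco p) (yco w)) by ring.
by rewrite -vt -wt; ring.
Qed.

(** This is the squared norm of the normal [(b, - 2 y)] of the sphere; on [X] it
    has the constant value [(1 - a1)^2]. *)
Lemma X_normal_gt0 p : X p ->
  0 < (1 + a1 - 2 * tco p) ^+ 2 + 4 * edot (yco p) (yco p).
Proof.
move=> /XsetP[_ <-].
rewrite [ltRHS](_ : _ = (1 - a1) ^+ 2); last by ring.
by rewrite exprn_gt0 // subr_gt0 (lt_trans a1_lt0 ltr01).
Qed.

(** The equations [h1], [h2] are submersive on the open set where [phi], the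
    squared norm of the normal of the sphere, is nonzero.  That set contains [X]
    by [X_normal_gt0]. *)
Lemma X_submanifold : submanifold n.+1 X.
Proof.
pose phi p := (1 + a1 - 2 * tco p) * (1 + a1 - 2 * tco p) +
  4 * edot (yco p) (yco p).
pose h1 p := zco p - tco p * c (xco p).
pose h2 p := (tco p - a1) * (1 - tco p) - edot (yco p) (yco p).
pose h p : 'rV[R]_2 := \row_i (if i == 0 then h1 p else h2 p).
have hE i : (fun p => h p 0 i) = if i == 0 then h1 else h2.
  by apply/funext => p; rewrite /h mxE; case: eqP.
have smc (U : set 'rV[R]_n.+3) i : open U ->
    smooth_on U (fun p : 'rV[R]_n.+3 => p 0 i).
  by move=> oU k; exact: Ck_on_coord.
have smy (U : set 'rV[R]_n.+3) : open U ->
    smooth_on U (fun p => edot (yco p) (yco p)).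
  move=> oU; apply: (smooth_on_sum oU) => j.
  under eq_fun do rewrite mxE.
  by apply: (smooth_onM oU); exact: smc.
have smk (U : set 'rV[R]_n.+3) a : open U ->
    smooth_on U (cst a : 'rV[R]_n.+3 -> R).
  by move=> oU; exact: smooth_on_cst.
have oU : open [set p | phi p != 0].
  have phic : continuous phi.
    have oT : open [set: 'rV[R]_n.+3] by exact: openT.
    have lin : smooth_on setT (fun p => 1 + a1 - 2 * tco p).
      apply: (smooth_onD oT (smk _ _ oT)); apply: (smooth_onN oT).
      exact: (smooth_onM oT (smk _ _ oT) (smc _ _ oT)).
    have phis : smooth_on setT phi.
      apply: (smooth_onD oT (smooth_onM oT lin lin)).
      exact: (smooth_onM oT (smk _ _ oT) (smy _ oT)).
    by move=> p; exact: phis 0%N p I.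
  have -> : [set p | phi p != 0] = phi @^-1` [set x | x != 0] by [].
  by apply: open_comp; [move=> p _; exact: phic | exact: open_neq].
have h1s : smooth_on [set p | phi p != 0] h1.
  apply: (smooth_onD oU (smc _ _ oU)); apply: (smooth_onN oU).
  apply: (smooth_onM oU (smc _ _ oU)) => k.
  exact: (Ck_on_comp1 oU c_smooth (smc _ _ oU k)).
have h2s : smooth_on [set p | phi p != 0] h2.
  apply: (smooth_onD oU _ (smooth_onN oU (smy _ oU))).
  apply: (smooth_onM oU (smooth_onD oU (smc _ _ oU) (smk _ _ oU))).
  exact: (smooth_onD oU (smk _ _ oU) (smooth_onN oU (smc _ _ oU))).
have hs : smooth_on [set p | phi p != 0] h.
  apply: (smooth_on_row oU) => i; rewrite hE.
  by case: eqP.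
have h0P p : h p = 0 <-> X p.
  split=> [/rowP hp|/XsetP[ez et]].
    apply/XsetP; have := hp 0; have := hp 1; rewrite !mxE /= => h2p h1p.
    by split; apply: subr0_eq.
  by apply/rowP => i; rewrite !mxE /h1 /h2 ez et !subrr; case: eqP.
exists 2%N; split; first by rewrite addn2.
move=> p Xp; exists [set p | phi p != 0], h; split=> //.
- by rewrite /= /phi -expr2 gt_eqF // X_normal_gt0.
- move=> q /= phi0 w.
  (* the direction along the normal (b, - 2 y) prescribes the derivative of h2,
     after which the z-coordinate corrects that of h1 *)
  pose be := w 0 1 / phi q.
  pose v := @point R n.+1 0
    (w 0 0 + be * (1 + a1 - 2 * tco q) * c (xco q))
    (be * (1 + a1 - 2 * tco q)) (- (2 * be) *: yco q).
  exists v.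
  have dh : differentiable h q by exact: (hs 1%N).1.
  have dc i : is_derive q v (fun p : 'rV[R]_n.+3 => p 0 i) (v 0 i).
    exact: is_derive_row_coord.
  have dcst a : is_derive q v (cst a : 'rV[R]_n.+3 -> R) 0.
    exact: is_derive_cst.
  have dx : is_derive q v (fun p => xco p) (xco v) by exact: dc.
  have dz : is_derive q v (fun p => zco p) (zco v) by exact: dc.
  have dt : is_derive q v (fun p => tco p) (tco v) by exact: dc.
  have dy : is_derive q v (fun p => edot (yco p) (yco p))
      (2 * edot (yco q) (yco v)).
    apply: is_derive_edot => j; rewrite mxE.
    by under eq_fun do rewrite mxE; exact: dc.
  have dcx := is_derive_comp1 (c_diff _) (differentiable_coord _ _ _) dx.
  have dh1 : is_derive q v h1 (w 0 0).
    apply: is_derive_eq (is_derive_subf dz (is_derive_mulf dt dcx)) _.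
    by rewrite !coE; ring.
  have dh2 : is_derive q v h2 (w 0 1).
    apply: is_derive_eq (is_derive_subf (is_derive_mulf
      (is_derive_subf dt (dcst a1)) (is_derive_subf (dcst 1) dt)) dy) _.
    rewrite !coE /= edotZr -[w 0 1](divfK phi0) -/be /phi.
    ring.
  have dhv : derivable h q v by exact: diff_derivable.
  rewrite -deriveE // (derive_mx dhv); apply/rowP => i; rewrite !mxE.
  rewrite hE; case: eqP => [->|/eqP i0]; first by have [_ ->] := dh1.
  have [_ ->] := dh2; congr (w _ _); apply: val_inj => /=.
  by case: i i0 => [[|[|i]] lti].
- apply/seteqP; split=> q [].
    by move=> Xq Uq; split=> //; exact/h0P.
  by move=> Uq /h0P Xq.
Qed.

(** * The first derivative *)

(** The quantities [D] and [E] for which the first derivative is the square root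
    of [D / (D + E)]. *)
Definition slope_den p : R :=
  c (xco p) ^+ 2 * edot (yco p) (yco p) + ((1 - a1) / 2) ^+ 2.

Definition slope_excess p : R := (tco p * c' (xco p) * ((1 - a1) / 2)) ^+ 2.

(** The shortest tangent vector with first coordinate 1.  Such a vector is
    determined by its [t]-component [tau] and its [y]-component [eta] with
    [b tau = 2 y.eta]; the shortest [eta] is [(b tau / 2 q) y], and
    [(t c' + tau c)^2 + tau^2 r^2 / q] is then minimal at
    [tau = - t c' c q / (c^2 q + r^2)].  The formulas in this form also hold for
    [y = 0]. *)
Definition upward p : 'rV[R]_n.+3 :=
  let a := tco p * c' (xco p) / slope_den p in
  @point R n.+1 1 (a * ((1 - a1) / 2) ^+ 2)
    (- a * c (xco p) * edot (yco p) (yco p))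
    (- a * c (xco p) * ((1 + a1 - 2 * tco p) / 2) *: yco p).

Lemma radius_gt0 : 0 < (1 - a1) / 2.
Proof. by rewrite divr_gt0 // subr_gt0 (lt_trans a1_lt0 ltr01). Qed.

Lemma slope_den_gt0 p : 0 < slope_den p.
Proof.
rewrite ltr_wpDl ?exprn_gt0 ?radius_gt0 //.
by rewrite mulr_ge0 ?sqr_ge0 ?edot_ge0.
Qed.

Lemma slope_excess_ge0 p : 0 <= slope_excess p.
Proof. exact: sqr_ge0. Qed.

Lemma slope_sum_gt0 p : 0 < slope_den p + slope_excess p.
Proof. by rewrite ltr_wpDr ?slope_excess_ge0 ?slope_den_gt0. Qed.

Lemma upward_tangent p : X p -> tangent_eqs p (upward p).
Proof.
move=> /XsetP[_ pq]; have D0 := lt0r_neq0 (slope_den_gt0 p).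
rewrite /tangent_eqs !coE; split.
  by move: D0; rewrite /slope_den; move: ((1 - a1) / 2) => r D0; field.
by rewrite edotZr; field.
Qed.

Lemma upward_orthogonal p w : X p -> tangent_eqs p w -> xco w = 0 ->
  edot (upward p) w = 0.
Proof.
move=> /XsetP[_ pq] [ez et] ex; have D0 := lt0r_neq0 (slope_den_gt0 p).
rewrite edot_coord !coE edotZl ez ex -pq.
have -> : edot (yco p) (yco w) = (1 + a1 - 2 * tco p) * tco w / 2.
  by rewrite et; field.
by field.
Qed.

Lemma upward_norm p : X p ->
  edot (upward p) (upward p) = (slope_den p + slope_excess p) / slope_den p.
Proof.
move=> /XsetP[_ pq]; have := lt0r_neq0 (slope_den_gt0 p).
rewrite edot_coord !coE edotZl edotZr /slope_excess /slope_den.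
(* (t, y) lies on the sphere of radius r *)
have -> : edot (yco p) (yco p) =
    ((1 - a1) / 2) ^+ 2 - ((1 + a1 - 2 * tco p) / 2) ^+ 2 by rewrite -pq; field.
move: ((1 - a1) / 2) ((1 + a1 - 2 * tco p) / 2) => r b D0.
by field.
Qed.

Lemma X_noncritical : critical_set X (@first_coord R n.+2) = set0.
Proof.
apply/seteqP; split=> // p [Xp crit].
have /(tangentP _ Xp) tu := upward_tangent Xp.
have /(first_coord_maps_to _ tu) := crit _ tu.
by rewrite coE => /esym/eqP; rewrite oner_eq0.
Qed.

(** If [v] and [w] are upward unit vectors with slopes [a] and [b], then
    [b v - a w] is in the kernel, hence orthogonal to both: [b = a (v.w)] and
    [a = b (v.w)], which forces [a^2 = b^2]. *)
Lemma upward_unit_unique p v w a b : X p ->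
  is_upward_unit X p v a -> is_upward_unit X p w b -> a = b.
Proof.
move=> Xp [tv vv pv /(first_coord_maps_to _ tv) av a0]
  [tw ww pw /(first_coord_maps_to _ tw) bw b0].
pose u := b *: v + (- a) *: w.
have ku : diff_kernel X (@first_coord R n.+2) p u.
  have tu : tangent X p u by exact: tangent_lin.
  split=> //; apply/first_coord_maps_to => //.
  by rewrite xco_lin -av -bw; ring.
have := pw u ku; have := pv u ku.
rewrite !(edotDr, edotZr) vv ww (edotC w v) => ea eb.
have : (a - b) * (a + b) = 0.
  have -> : (a - b) * (a + b) = a * (a * 1) - b * (b * 1) by ring.
  have -> : a * (a * 1) = a * (b * edot v w) by congr (a * _); lra.
  have -> : b * (b * 1) = b * (a * edot v w) by congr (b * _); lra.
  ring.
move=> /eqP; rewrite mulf_eq0 (gt_eqF (addr_gt0 a0 b0)) orbF.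
by move=> /eqP/subr0_eq.
Qed.

Lemma first_derivativeE p : X p -> first_derivative X p =
  Num.sqrt (slope_den p / (slope_den p + slope_excess p)).
Proof.
move=> Xp; set a := Num.sqrt _.
have D0 := slope_den_gt0 p; have E0 := slope_sum_gt0 p.
have a0 : 0 < a by rewrite sqrtr_gt0 divr_gt0.
have ua : is_upward_unit X p (a *: upward p) a.
  have au : a *: upward p = a *: upward p + 0 *: upward p.
    by rewrite scale0r addr0.
  have xa : xco (a *: upward p) = a.
    by rewrite au xco_lin coE mul0r addr0 mulr1.
  have tu : tangent X p (a *: upward p).
    have tu : tangent X p (upward p).
      by apply/tangentP => //; exact: upward_tangent.
    by rewrite au; exact: tangent_lin.
  split=> //.
  - have H0 : 0 <= slope_den p / (slope_den p + slope_excess p).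
      by rewrite divr_ge0 // ltW.
    rewrite edotZl edotZr mulrA -expr2 sqr_sqrtr //.
    rewrite upward_norm //; field.
    by rewrite !lt0r_neq0.
  - move=> w [tw /(first_coord_maps_to _ tw) wx].
    rewrite edotZl upward_orthogonal ?mulr0 //.
    exact/tangentP.
  - by apply/first_coord_maps_to; rewrite ?xa.
apply: xget_unique; first by exists (a *: upward p).
by move=> b [w ub]; exact: upward_unit_unique ub ua.
Qed.

Lemma first_derivative_eq1 p : X p ->
  first_derivative X p = 1 <-> tco p * c' (xco p) = 0.
Proof.
move=> Xp; rewrite first_derivativeE //.
have D0 := slope_den_gt0 p; have E0 := slope_sum_gt0 p.
split=> [s1|tc0]; last first.
  by rewrite /slope_excess tc0 mul0r expr0n addr0 divff ?sqrtr1 // lt0r_neq0.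
have /eqP : slope_den p / (slope_den p + slope_excess p) = 1.
  by rewrite -[LHS]sqr_sqrtr ?s1 ?expr1n // divr_ge0 // ltW.
rewrite -subr_eq0 => /eqP q1.
have /eqP : slope_excess p = 0.
  apply/eqP; rewrite -oppr_eq0; apply/eqP.
  rewrite -[RHS](mul0r (slope_den p + slope_excess p)) -q1; field.
  by rewrite lt0r_neq0.
by rewrite sqrf_eq0 mulf_eq0 (gt_eqF radius_gt0) orbF => /eqP.
Qed.

Definition slope_var p v : R :=
  let b := 1 + a1 - 2 * tco p in
  let t := tco p in
  t * c' (xco p) *
  (t * c' (xco p) * (2 * c (xco p) * c' (xco p) * xco v * edot (yco p) (yco p)
                     + c (xco p) ^+ 2 * b * tco v)
   - 2 * slope_den p * (tco v * c' (xco p) + t * (c'' (xco p) * xco v))).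

(** Along a curve of [X] with velocity [v], the derivative of [D / (D + E)] is
    [(D' E - D E') / (D + E)^2], and [D' E - D E'] is [r^2] times [slope_var].
    So the first derivative varies along the curve at the rate [slope_var] times
    the positive factor [K]. *)
Lemma first_derivative_maps_to0 p v : X p -> tangent X p v ->
  diff_maps_to X (first_derivative X) p v 0 <-> slope_var p v = 0.
Proof.
move=> Xp tv.
have D0 := slope_den_gt0 p; have E0 := slope_sum_gt0 p.
pose K := (2 * Num.sqrt (slope_den p / (slope_den p + slope_excess p)))^-1 *
  (((1 - a1) / 2) ^+ 2 / (slope_den p + slope_excess p) ^+ 2).
have K0 : K != 0.
  rewrite mulf_neq0 //.
    by rewrite invr_eq0 mulf_neq0 // lt0r_neq0 // sqrtr_gt0 divr_gt0.
  by rewrite lt0r_neq0 // divr_gt0 // exprn_gt0 // radius_gt0.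
have main g : curve_in X p v g ->
    is_derive (0 : R) 1 (first_derivative X \o g) (K * slope_var p v).
  move=> gX; have dg := curve_is_derive gX; have [g0 _ _] := gX.
  have [_ vt] := tangent_eqs_of_curve gX.
  have dx : is_derive (0 : R) 1 (fun s => xco (g s)) (xco v) by exact: dg.
  have dt : is_derive (0 : R) 1 (fun s => tco (g s)) (tco v) by exact: dg.
  have dy : is_derive (0 : R) 1 (fun s => edot (yco (g s)) (yco (g s)))
      (2 * edot (yco (g 0)) (yco v)).
    apply: is_derive_edot => j; rewrite mxE.
    by under eq_fun do rewrite mxE; exact: dg.
  have diffx : differentiable (fun s => xco (g s)) (0 : R).
    by apply/derivable1_diffP; have [] := dx.
  have dcx := is_derive_comp1 (c_diff _) diffx dx.
  have dc'x := is_derive_comp1 (c'_diff _) diffx dx.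
  have dcst a : is_derive (0 : R) 1 (cst a : R -> R) 0 by exact: is_derive_cst.
  have dden : is_derive (0 : R) 1 (fun s => slope_den (g s))
    (2 * c (xco p) * c' (xco p) * xco v * edot (yco p) (yco p) +
     c (xco p) ^+ 2 * ((1 + a1 - 2 * tco p) * tco v)).
    apply: is_derive_eq
      (is_derive_addf (is_derive_mulf (is_derive_mulf dcx dcx) dy) (dcst _)) _.
    by rewrite g0 /= vt; ring.
  have dtc := is_derive_mulf (is_derive_mulf dt dc'x) (dcst ((1 - a1) / 2)).
  have dexc : is_derive (0 : R) 1 (fun s => slope_excess (g s))
    (2 * ((1 - a1) / 2) ^+ 2 * (tco p * c' (xco p)) *
      (tco v * c' (xco p) + tco p * (c'' (xco p) * xco v))).
    apply: is_derive_eq (is_derive_mulf dtc dtc) _.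
    by rewrite g0 /=; ring.
  have sum0 : slope_den (g 0) + slope_excess (g 0) != 0.
    by rewrite g0 lt0r_neq0.
  have dq := is_derive_mulf dden (@is_derive_invf R R
    (fun s => slope_den (g s) + slope_excess (g s)) 0 1 _ sum0
    (is_derive_addf dden dexc)).
  set q := (fun s => slope_den (g s) / _) in dq.
  have dsqrt : is_derive (q 0) 1 Num.sqrt (2 * Num.sqrt (q 0))^-1.
    by apply: is_derive1_sqrt; rewrite /q g0 divr_gt0.
  apply: (near_eq_is_derive (f := Num.sqrt \o q)).
    by apply: filterS (curve_near gX) => s Xs /=; rewrite first_derivativeE.
  apply: is_derive_eq (is_derive1_comp dsqrt dq) _.
  rewrite /q g0 /K -[RHS]mulrA; congr (_ * _); rewrite /slope_var /slope_excess.
  have S0 : slope_den p + (tco p * c' (xco p) * ((1 - a1) / 2)) ^+ 2 != 0.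
    exact: lt0r_neq0 E0.
  by move: ((1 - a1) / 2) S0 => r S0; field.
split=> [dm|s0 g gX].
  have [g gX] := tv; have [_ E] := main g gX; have [_ E'] := dm g gX.
  move: E; rewrite E' => /esym/eqP; rewrite mulf_eq0 (negPf K0) /=.
  by move=> /eqP.
by have := main g gX; rewrite s0 mulr0.
Qed.

(** * The critical set of the first derivative *)

Lemma X_t_range p : X p -> a1 <= tco p <= 1.
Proof. by move=> [x [z [t [y [-> ? _ _]]]]]; rewrite coE. Qed.

(** Where [t c'(x)] is nonzero, the tangent vector [upward] detects [c''(x)] at
    a pole, and away from the poles a tangent vector that moves [t] but not [x]
    shows that the point is not critical. *)
Lemma critical_first_derivative p :
  critical_set X (first_derivative X) p <->
  X p /\ (tco p * c' (xco p) = 0 \/ (yco p = 0 /\ c'' (xco p) = 0)).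
Proof.
split=> [[Xp crit]|[Xp deg]]; split=> //; last first.
  move=> v tv; apply/first_derivative_maps_to0 => //; rewrite /slope_var.
  have [->|[y0 ->]] := deg; first by rewrite mul0r.
  have tv0 : tco v = 0.
    have [_ /eqP] := (tangentP v Xp).1 tv; rewrite y0 edot0l mulr0 mulf_eq0.
    case/orP => /eqP // b0; have := X_normal_gt0 Xp.
    by rewrite b0 y0 edot0l mulr0 expr0n addr0 ltxx.
  by rewrite tv0 y0 edot0l; ring.
have var0 v : tangent_eqs p v -> slope_var p v = 0.
  move=> /(tangentP v Xp) tv.
  by apply/(first_derivative_maps_to0 Xp tv); exact: crit.
have [tc0|tc0] := eqVneq (tco p * c' (xco p)) 0; [by left | right].
have D0 := lt0r_neq0 (slope_den_gt0 p).
have [t0 c0] : tco p != 0 /\ c' (xco p) != 0.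
  by apply/andP; rewrite -negb_or -mulf_eq0.
have [y0|y0] := eqVneq (yco p) 0.
  split=> //; have /eqP := var0 _ (upward_tangent Xp).
  rewrite /slope_var !coE y0 edot0l !(mulr0, mul0r, mulr1, add0r) mulf_eq0.
  rewrite (negPf tc0) /= oppr_eq0 !mulf_eq0 (negPf D0) (negPf t0) pnatr_eq0 /=.
  by move=> /eqP.
exfalso; have /XsetP[_ pq] := Xp.
have q0 : edot (yco p) (yco p) != 0 by apply: contra_neq y0; exact: edot_eq0.
pose w := @point R n.+1 0 (c (xco p)) 1
  (((1 + a1 - 2 * tco p) / 2 / edot (yco p) (yco p)) *: yco p).
have /eqP : slope_var p w = 0.
  apply: var0; rewrite /tangent_eqs !coE edotZr; split; first by ring.
  by field.
rewrite /slope_var !coE mulf_eq0 (negPf tc0) /= => /eqP E.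
(* slope_var p w is - t c' times the left-hand side, which is c' times a
   positive number since a1 <= t <= 1 *)
have : c' (xco p) * (c (xco p) ^+ 2 *
    ((1 - tco p) * - a1 + (tco p - a1)) + 2 * ((1 - a1) / 2) ^+ 2) = 0.
  rewrite -[RHS]oppr0 -E /slope_den -pq.
  by move: ((1 - a1) / 2) => r; ring.
have /andP[t1 t2] := X_t_range Xp.
move=> /eqP; rewrite mulf_eq0 (negPf c0) /= gt_eqF //.
apply: ltr_wpDl; last by rewrite mulr_gt0 // exprn_gt0 // radius_gt0.
rewrite mulr_ge0 ?sqr_ge0 // addr_ge0 ?subr_ge0 //.
by rewrite mulr_ge0 ?subr_ge0 // oppr_ge0 ltW.
Qed.

Lemma X_pole p : X p -> yco p = 0 <-> tco p = 1 \/ tco p = a1.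
Proof.
move=> /XsetP[_ pq]; split=> [y0|t1].
  move: pq; rewrite y0 edot0l => /eqP; rewrite mulf_eq0 !subr_eq0.
  by case/orP => /eqP; [right | left].
apply: edot_eq0; rewrite -pq.
by case: t1 => ->; rewrite subrr ?mulr0 ?mul0r.
Qed.

End Hypersurface.

Theorem theorem5 (R : realType) (m : nat) (c : R -> R) (a1 a2 : R)
    (hm : (2 <= m)%N)
    (c_smooth : smooth_on [set: R] c)
    (c_pos : forall x, 0 < c x)
    (ha1 : a1 < 0) (ha2 : a2 = 1) :
  let X := Xset m c a1 a2 in
  let f := first_derivative X in
  let C1 := fun p : 'rV[R]_m.+2 =>
    exists x1, p = point x1 (c x1) 1 0 /\ c^`(2) x1 = 0 in
  let C2 := fun p : 'rV[R]_m.+2 =>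
    exists x1, p = point x1 (a1 * c x1) a1 0 /\ c^`(2) x1 = 0 in
  let C3 := fun p : 'rV[R]_m.+2 =>
    exists x1 y, p = point x1 0 0 y in
  let C4 := fun p : 'rV[R]_m.+2 =>
    exists x1 t y, p = point x1 (t * c x1) t y /\ c^`() x1 = 0 in
  [/\ submanifold m X,
      critical_set X (@first_coord R m.+1) = set0,
      critical_set X f = [set p | X p /\ (C1 p \/ C2 p \/ C3 p \/ C4 p)]
    & forall p, X p -> (C3 p \/ C4 p <-> f p = 1)].
Proof.
case: m hm => // n _; rewrite {}ha2 => X f C1 C2 C3 C4.
have C34 p : X p -> (C3 p \/ C4 p) <-> tco p * c^`()%classic (xco p) = 0.
  move=> Xp; have /(XsetP c ha1)[pz _] := Xp; split.
    case=> [[x [y ->]]|[x [t [y [-> c0]]]]]; rewrite !coE ?mul0r //.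
    by rewrite c0 mulr0.
  move=> /eqP; rewrite mulf_eq0 => /orP[]/eqP e0.
    by left; exists (xco p), (yco p); rewrite {1}(point_coord p) pz e0 mul0r.
  right; exists (xco p), (tco p), (yco p); split=> //.
  by rewrite {1}(point_coord p) pz.
have C12 p : X p ->
    (C1 p \/ C2 p) <-> yco p = 0 /\ c^`()^`()%classic (xco p) = 0.
  move=> Xp; have /(XsetP c ha1)[pz _] := Xp; split.
    by case=> [[x [-> c0]]|[x [-> c0]]]; rewrite !coE.
  move=> [y0 c0]; have [t1|t1] := (X_pole ha1 Xp).1 y0; [left | right].
    by exists (xco p); split=> //; rewrite {1}(point_coord p) pz t1 y0 mul1r.
  by exists (xco p); split=> //; rewrite {1}(point_coord p) pz t1 y0.
split.
- exact: X_submanifold.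
- exact: X_noncritical.
- apply/seteqP; split=> p.
    move=> /(critical_first_derivative c_smooth ha1)[Xp].
    by move=> [/(C34 p Xp)|/(C12 p Xp)] ?; split=> //; tauto.
  move=> [Xp C]; apply/(critical_first_derivative c_smooth ha1); split=> //.
  have : (C1 p \/ C2 p) \/ (C3 p \/ C4 p) by tauto.
  by move=> [/(C12 p Xp)|/(C34 p Xp)]; tauto.
- move=> p Xp; rewrite (first_derivative_eq1 c_smooth ha1 Xp); exact: C34.
Qed.
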